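(* Let $\mathcal{G}(z)$ be a generating function of the form and satisfying the assumptions stated in the context. Then $\mathcal{G}(z)$ has an $n$-order discrete-time PH representation $(\widetilde\alpha,\widetilde A)$ if and only if $\mathcal{G}(1/(s+1))$ has an $n$-order continuous-time PH representation $(\widetilde\alpha,A)$ with all diagonal entries of $A$ larger than or equal to $-1$.
   Context: Vectors are row vectors; $\mathbf{1}$ is the all-ones vector and $I$ the identity matrix. Setting. $\mathcal{G}$ is the generating function of a nonnegative-integer-valued random variable, of the form $$\mathcal{G}(z)=\frac{\widetilde p(z)}{\widetilde q(z)}=\frac{\widetilde p_nz^n+\widetilde p_{n-1}z^{n-1}+\cdots+\widetilde p_1z}{\widetilde q_nz^n+\widetilde q_{n-1}z^{n-1}+\cdots+\widetilde q_1 z+1},\qquad |z|\le1,$$ such that: (Ã1) the coefficients are real; (Ã2) $\widetilde p_n^2+\widetilde q_n^2\ne0$, and $\widetilde p$ and $\widetilde q$ are coprime; (Ã3) $\mathcal{G}(1)=1$ and the (unique) root of minimal modulus of $\widetilde q(z)$ is real and strictly greater than $1$ (regarded as vacuously satisfied when $\widetilde q$ is constant). Discrete-time PH representation. An $n$-order discrete-time PH representation of $\mathcal{G}$ is a pair $(\widetilde\alpha,\widetilde A)$ with $\widetilde\alpha\in\mathbb{R}^n$ entrywise nonnegative, $\widetilde\alpha\mathbf{1}^\top=1$, and $\widetilde A\in\mathbb{R}^{n\times n}$ a substochastic matrix (nonnegative entries, row sums at most $1$) with $I-\widetilde A$ nonsingular, such that $\mathcal{G}(z)=z\widetilde\alpha(I-\widetilde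 A)(I-z\widetilde A)^{-1}\mathbf{1}^\top$ for $|z|\le1$. Continuous-time PH representation. An $n$-order continuous-time PH representation of a rational function $\mathcal{L}(s)$ is a pair $(\alpha,A)$ with $\alpha\in\mathbb{R}^n$ entrywise nonnegative, $\alpha\mathbf{1}^\top=1$, and $A=(a_{ij})\in\mathbb{R}^{n\times n}$ nonsingular with $a_{ii}<0$ for all $i$, $a_{ij}\ge0$ for $i\ne j$, $\sum_ja_{ij}\le0$ for all $i$, such that $\mathcal{L}(s)=-\alpha A(sI-A)^{-1}\mathbf{1}^\top$ for $\mathrm{Re}(s)\ge0$. *)

(* Defs.v *)
(* MathComp-Analysis, with the complex numbers R[i] over R : realType. *)
From HB Require Import structures.
From mathcomp Require Export all_boot all_order all_algebra.
From mathcomp Require Export complex.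
From mathcomp Require Export all_classical all_reals all_analysis.

Set Implicit Arguments.
Unset Strict Implicit.
Unset Printing Implicit Defensive.

Import Order.TTheory GRing.Theory Num.Theory.
Import numFieldNormedType.Exports.

Local Open Scope classical_set_scope.
Local Open Scope ring_scope.
Local Open Scope complex_scope.

(* Convergence is for the norm topology of the numeric field R[i]; on R[i] both
   the norm and the order are R[i]-valued, and [`|z| <= 1] holds exactly when
   the modulus of z is at most 1. *)
Definition is_generating_function (R : realType) (d : measure_display)
    (T : measurableType d) (P : probability T R) (X : {RV P >-> nat})
    (G : R[i] -> R[i]) : Prop :=
  forall z : R[i], `|z| <= 1 ->
    (series (fun k : nat => (fine (P (X @^-1` [set k])))%:C * z ^+ k)
       : nat -> (R[i] : numFieldType))
      @ \oo --> (G z : (R[i] : numFieldType)).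

Definition cpoly (R : realType) (p : {poly R}) : {poly R[i]} :=
  map_poly (real_complex R) p.

Definition cmx (R : realType) (m n : nat) (A : 'M[R]_(m, n)) : 'M[R[i]]_(m, n) :=
  map_mx (real_complex R) A.

Definition rational_form (R : realType) (n : nat) (p q : {poly R})
    (G : R[i] -> R[i]) : Prop :=
  [/\ (size p <= n.+1)%N, (size q <= n.+1)%N, p`_0 = 0, q`_0 = 1
    & forall z : R[i], `|z| <= 1 -> G z = (cpoly p).[z] / (cpoly q).[z]].

(* Uniqueness is that of the root as a complex number; its multiplicity is
   unrestricted. *)
Definition min_modulus_root (R : realType) (q : {poly R}) (r : R) : Prop :=
  root (cpoly q) r%:C /\
  forall z : R[i], root (cpoly q) z -> z != r%:C -> `|r%:C| < `|z|.

(* No condition when q is constant. *)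
Definition real_dominant_pole (R : realType) (q : {poly R}) : Prop :=
  (1 < size q)%N -> exists2 r : R, 1 < r & min_modulus_root q r.

Definition is_prob_vector (R : realType) (n : nat) (alpha : 'rV[R]_n) : Prop :=
  (forall i, 0 <= alpha 0 i) /\ \sum_i alpha 0 i = 1.

Definition is_substochastic (R : realType) (n : nat) (A : 'M[R]_n) : Prop :=
  (forall i j, 0 <= A i j) /\ (forall i, \sum_j A i j <= 1).

(* [invmx M] is the inverse of M only for invertible M.  A substochastic A with
   I - A invertible has all its eigenvalues of modulus < 1, so that I - z A is
   invertible for every |z| <= 1. *)
Definition is_dph_representation (R : realType) (n : nat) (G : R[i] -> R[i])
    (alpha : 'rV[R]_n) (A : 'M[R]_n) : Prop :=
  [/\ is_prob_vector alpha, is_substochastic A, 1%:M - A \in unitmx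
    & forall z : R[i], `|z| <= 1 ->
        G z = z * (cmx alpha *m (1%:M - cmx A) *m invmx (1%:M - z *: cmx A)
                     *m (const_mx 1 : 'cV_n)) 0 0].

Definition is_subgenerator (R : realType) (n : nat) (A : 'M[R]_n) : Prop :=
  [/\ forall i, A i i < 0, forall i j, i != j -> 0 <= A i j
    & forall i, \sum_j A i j <= 0].

(* By Gershgorin, an invertible subgenerator has all its eigenvalues of negative
   real part, so that s I - A is invertible whenever Re s >= 0. *)
Definition is_cph_representation (R : realType) (n : nat) (L : R[i] -> R[i])
    (alpha : 'rV[R]_n) (A : 'M[R]_n) : Prop :=
  [/\ is_prob_vector alpha, is_subgenerator A, A \in unitmx
    & forall s : R[i], 0 <= complex.Re s ->
        L s = - (cmx alpha *m cmx A *m invmx (s%:M - cmx A)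
                   *m (const_mx 1 : 'cV_n)) 0 0].

(* Main.v *)
(** Take [A = A' - I].  With [z = 1 / (s + 1)] one has
    [s I - A = (s + 1) (I - z A')], so the two resolvents agree for [Re s >= 0],
    where [`|z| <= 1].  Invertibility of [I - z A'] on the closed disc follows
    from the positive vector [(I - A')^-1 1], used as a weight in a Gershgorin
    argument.  As [s] only reaches the part [Re (1 / z) >= 1] of the disc, the
    converse extends the identity as one between polynomials, verified at
    [z = 1 / (k + 1)] for all natural [k]; the assumption on the roots of [q]
    keeps the denominators nonzero on the disc. *)
Require Import Defs.
From mathcomp Require Import lra.

Set Implicit Arguments.
Unset Strict Implicit.
Unset Printing Implicit Defensive.

Import Order.TTheory GRing.Theory Num.Theory.
Import numFieldNormedType.Exports.

Local Open Scope classical_set_scope.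
Local Open Scope ring_scope.
Local Open Scope complex_scope.

(** Minimum principle: if the least entry [x_m] were negative, row sums at most 1 would give
    [x_m >= 1 + x_m]. Hence [x >= 0], and [x = 1 + A x] makes every entry positive. *)
Lemma substochastic_potential_gt0 (R : realType) (n : nat) (A : 'M[R]_n)
    (x : 'cV[R]_n) :
  is_substochastic A -> (1%:M - A) *m x = const_mx 1 -> forall i, 0 < x i 0.
Proof.
move=> [A0 A1] xE; have xi i : x i 0 = 1 + \sum_j A i j * x j 0.
  move/matrixP/(_ i 0): xE; rewrite mulmxBl mul1mx !mxE => <-.
  by rewrite subrK.
have x0 i : 0 <= x i 0.
  case: (arg_minP (fun j => x j 0) (isT : predT i)) => m _ mP.
  apply: le_trans (mP i isT); rewrite leNgt; apply/negP => xm.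
  have : 1 + (\sum_j A m j) * x m 0 <= x m 0.
    rewrite [leRHS]xi lerD2l mulr_suml; apply: ler_sum => j _.
    by rewrite ler_wpM2l ?mP.
  have : x m 0 <= (\sum_j A m j) * x m 0.
    by rewrite ler_niMl // ltW.
  by lra.
by move=> i; rewrite xi ltr_pwDl // sumr_ge0 // => j _; rewrite mulr_ge0.
Qed.

(** Maximum principle relative to the positive weight [x = (I - A)^-1 1]: since [A x = x - 1]
    decreases strictly, the largest ratio [w_j / x_j] cannot be positive. *)
Lemma substochastic_subharmonic_le0 (R : realType) (n : nat) (A : 'M[R]_n)
    (w : 'I_n -> R) :
  is_substochastic A -> 1%:M - A \in unitmx ->
  (forall i, w i <= \sum_j A i j * w j) -> forall i, w i <= 0.
Proof.
move=> sA uA wA i.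
have [x xE] : exists x : 'cV[R]_n, (1%:M - A) *m x = const_mx 1.
  by exists (invmx (1%:M - A) *m const_mx 1); rewrite mulKVmx.
have x0 := substochastic_potential_gt0 sA xE.
have xi k : \sum_j A k j * x j 0 = x k 0 - 1.
  move/matrixP/(_ k 0): xE; rewrite mulmxBl mul1mx !mxE => <-.
  by rewrite subKr.
(* With [m] maximizing [c = w m / x m 0], [c x_m <= c (A x)_m = c (x_m - 1)]. *)
case: (arg_maxP (fun j => w j / x j 0) (isT : predT i)) => m _ mP.
pose c := w m / x m 0.
have wc j : w j <= c * x j 0 by rewrite -ler_pdivrMr //; exact: mP.
have wm : w m = c * x m 0 by rewrite /c divfK // gt_eqF.
have c0 : c <= 0.
  have : w m <= c * (x m 0 - 1).
    apply: le_trans (wA m) _; rewrite -xi mulr_sumr; apply: ler_sum => j _.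
    by rewrite mulrCA ler_wpM2l //; case: sA => + _; apply.
  by rewrite wm; lra.
by apply: le_trans (wc i) _; rewrite mulr_le0_ge0 // ltW.
Qed.

(** If [u = z A u] with [|z| <= 1], the moduli of the entries of [u] are subharmonic for [A], so
    they vanish. *)
Lemma unitmx_1_sub_scale (R : realType) (n : nat) (A : 'M[R]_n) (z : R[i]) :
  is_substochastic A -> 1%:M - A \in unitmx -> `|z| <= 1 ->
  1%:M - z *: cmx A \in unitmx.
Proof.
(* [kermx] is a left kernel; transposing turns it into the right kernel, where the row sums of [A]
   act. *)
move=> sA uA z1; rewrite -unitmx_tr -row_free_unit -kermx_eq0.
apply/rowV0P => u /sub_kermxP uM.
have uE i : u 0 i = z * \sum_j (A i j)%:C * u 0 j.
  move/matrixP/(_ 0 i): uM; rewrite linearB /= mulmxBr trmx1 mulmx1 !mxE.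
  move/eqP; rewrite subr_eq0 => /eqP ->; rewrite mulr_sumr.
  by apply: eq_bigr => j _; rewrite !mxE mulrC mulrA.
have normE (y : R[i]) : `|y| = (complex.Re `|y|)%:C.
  by rewrite RRe_real ?normr_real.
apply/rowP => i; rewrite mxE; apply/eqP; rewrite -normr_eq0 eq_le normr_ge0 andbT.
rewrite normE -(rmorph0 (real_complex R)) lecR.
pose w j := complex.Re `|u 0 j|.
apply: (substochastic_subharmonic_le0 (w := w) sA uA) => k; rewrite /w.
rewrite -lecR -normE rmorph_sum /= {1}uE normrM.
apply: le_trans (ler_piMl _ z1) _ => //.
apply: le_trans (ler_norm_sum _ _ _) _; apply: ler_sum => j _.
rewrite rmorphM /= -normE normrM ger0_norm // -(rmorph0 (real_complex R)) lecR.
by case: sA => + _; apply.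
Qed.

Lemma cmxB1 (R : realType) (n : nat) (A : 'M[R]_n) :
  cmx (A - 1%:M) = cmx A - 1%:M.
Proof. by rewrite /cmx map_mxB map_mx1. Qed.

Lemma dph_resolvent (R : realType) (n : nat) (alpha : 'rV[R]_n) (A : 'M[R]_n)
    (s : R[i]) :
  s + 1 != 0 -> 1%:M - (s + 1)^-1 *: cmx A \in unitmx ->
  - (cmx alpha *m cmx (A - 1%:M) *m invmx (s%:M - cmx (A - 1%:M))
       *m (const_mx 1 : 'cV_n)) 0 0 =
  (s + 1)^-1 * (cmx alpha *m (1%:M - cmx A)
       *m invmx (1%:M - (s + 1)^-1 *: cmx A) *m (const_mx 1 : 'cV_n)) 0 0.
Proof.
move=> s1 uM; rewrite cmxB1.
have -> : s%:M - (cmx A - 1%:M) = (s + 1) *: (1%:M - (s + 1)^-1 *: cmx A).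
  rewrite scalerBr scalerA divff // scale1r scalemx1 [(s + 1)%:M]raddfD /=.
  by rewrite opprB addrA.
rewrite invmxZ ?unitmxZ ?unitfE // -scalemxAr -scalemxAl.
by rewrite -(opprB 1%:M) mulmxN !mulNmx scalerN !mxE opprK.
Qed.

Lemma norm_inv_add1_le1 (R : realType) (s : R[i]) :
  0 <= complex.Re s -> s + 1 != 0 /\ `|(s + 1)^-1| <= 1.
Proof.
move=> s0; have : 1 <= `|s + 1|.
  apply: le_trans (normc_ge_Re _); rewrite -(rmorph1 (real_complex R)) lecR.
  by apply: le_trans (ler_norm _); case: s s0 => a b /=; rewrite lerDr.
move=> h; have n0 : 0 < `|s + 1| by exact: lt_le_trans h.
by split; [rewrite -normr_gt0 | rewrite normfV invf_le1].
Qed.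

Lemma horner_map_mxC (K : comNzRingType) (m n : nat) (A : 'M[K]_(m, n)) (z : K) :
  map_mx (horner_eval z) (map_mx polyC A) = A.
Proof. by apply/matrixP => i j; rewrite !mxE /horner_eval hornerC. Qed.

(* Cramer's rule makes the resolvent a quotient of polynomials in [z]. *)
Lemma dph_rational (K : fieldType) (n : nat) (a : 'rV[K]_n) (A : 'M[K]_n)
    (b : 'cV[K]_n) :
  exists u v : {poly K},
    forall z, v.[z] = \det (1%:M - z *: A) /\
     (v.[z] != 0 -> (a *m invmx (1%:M - z *: A) *m b) 0 0 = u.[z] / v.[z]).
Proof.
pose M : 'M[{poly K}]_n := 1%:M - 'X *: map_mx polyC A.
pose N := map_mx polyC a *m \adj M *m map_mx polyC b.
exists (N 0 0), (\det M) => z.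
have Mz : map_mx (horner_eval z) M = 1%:M - z *: A.
  rewrite /M map_mxB map_mx1 map_mxZ horner_map_mxC.
  by rewrite /= /horner_eval hornerX.
have vz : (\det M).[z] = \det (1%:M - z *: A).
  by rewrite -Mz det_map_mx.
split=> // v0; rewrite vz in v0 *.
have -> : (N 0 0).[z] = (a *m \adj (1%:M - z *: A) *m b) 0 0.
  have -> : (N 0 0).[z] = (map_mx (horner_eval z) N) 0 0 by rewrite [RHS]mxE.
  by rewrite -Mz -map_mx_adj /N !map_mxM !horner_map_mxC.
rewrite /invmx unitmxE unitfE v0 -scalemxAr -scalemxAl mxE.
by rewrite mulrC.
Qed.

Lemma poly_eq0_inv_nat (K : numFieldType) (f : {poly K}) :
  (forall k : nat, f.[k.+1%:R^-1] = 0) -> f = 0.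
Proof.
move=> f0; apply/eqP; apply/negPn/negP => /max_poly_roots.
(* These are [size f] distinct roots, one more than the degree of a nonzero [f] allows. *)
pose s : seq K := [seq k.+1%:R^-1 | k <- iota 0 (size f)].
move/(_ s); rewrite size_map size_iota ltnn.
suff : all (root f) s && uniq s by case/andP => -> -> /(_ isT isT).
apply/andP; split; first by apply/allP => _ /mapP[k _ ->]; rewrite rootE f0.
rewrite map_inj_uniq ?iota_uniq // => k l /invr_inj /eqP.
by rewrite eqr_nat => /eqP [].
Qed.

(** A root is either [r] or of larger modulus, hence outside the closed disc as [r > 1]; a constant
    [q] equals 1 by its constant coefficient. *)
Lemma real_dominant_pole_neq0 (R : realType) (q : {poly R}) (z : R[i]) :
  q`_0 = 1 -> real_dominant_pole q -> `|z| <= 1 -> (cpoly q).[z] != 0.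
Proof.
move=> q0 hq z1; have [sq|sq] := ltnP 1 (size q); last first.
  by rewrite (size1_polyC sq) q0 /cpoly map_polyC /= hornerC oner_neq0.
have [r r1 [_ rP]] := hq sq; apply/negP => /rP rz.
have rn : 1 < `|r%:C|.
  rewrite normc_def /= expr0n addr0 sqrtr_sqr ltcR.
  by rewrite (lt_le_trans r1) ?ler_norm.
have : `|z| < `|r%:C| by exact: le_lt_trans z1 rn.
have [->|/rz] := eqVneq z r%:C; first by rewrite ltxx.
by move=> h1 /(lt_trans h1); rewrite ltxx.
Qed.

Theorem theorem3 (R : realType) (d : measure_display) (T : measurableType d)
    (P : probability T R) (X : {RV P >-> nat}) (G : R[i] -> R[i])
    (n : nat) (p q : {poly R})
    (hG : is_generating_function X G)
    (hform : rational_form n p q G)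
    (hlead : p`_n ^+ 2 + q`_n ^+ 2 != 0)
    (hcop : coprimep p q)
    (hG1 : G 1 = 1)
    (hpole : real_dominant_pole q)
    (alpha : 'rV[R]_n) :
  (exists A' : 'M[R]_n, is_dph_representation G alpha A')
  <->
  (exists A : 'M[R]_n,
     is_cph_representation (fun s : R[i] => G (1 / (s + 1))) alpha A
     /\ forall i : 'I_n, -1 <= A i i).
Proof.
have [_ _ p0 q0 GE] := hform.
split=> [[A' [ha sA uA GA]]|[A [[ha [Ad An As] uA GA] Ab]]].
  have [A0 A1] := sA; exists (A' - 1%:M); split; last first.
    by move=> i; rewrite !mxE eqxx lerDr.
  split=> //.
  - split=> [i|i j ij|i].
    + rewrite !mxE eqxx subr_lt0 lt_neqAle; apply/andP; split; last first.
        apply: le_trans (A1 i); rewrite (bigD1 i) //= lerDl.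
        by rewrite sumr_ge0.
      (* A diagonal entry 1 exhausts the row sum, so the rest of row [i] of [A'] is zero; then row
         [i] of [I - A'] vanishes, and so does its determinant. *)
      apply/eqP => Aii; move: uA; rewrite unitmxE unitfE => /negP; apply.
      have Aij j : j != i -> A' i j = 0.
        move=> ji; apply/eqP; rewrite eq_le A0 andbT.
        move: (A1 i); rewrite (bigD1 i) //= Aii gerDl (bigD1 j) //=.
        by apply: le_trans; rewrite lerDl sumr_ge0.
      rewrite (expand_det_row _ i) big1 // => j _; rewrite !mxE.
      have [->|ji] := eqVneq j i; first by rewrite Aii subrr mul0r.
      by rewrite Aij // subrr mul0r.
    + by rewrite !mxE (negbTE ij) subr0.
    + under eq_bigr do rewrite !mxE.
      rewrite sumrB subr_le0 [leRHS](bigD1 i) //= [X in _ <= _ + X]big1 ?eqxx ?addr0 //.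
      by move=> j; rewrite eq_sym => /negbTE ->.
  - by rewrite -opprB -scaleN1r unitmxZ ?unitrN1.
  - move=> s s0; have [s1 z1] := norm_inv_add1_le1 s0.
    by rewrite div1r GA // dph_resolvent // unitmx_1_sub_scale.
pose A' := A + 1%:M.
have AE : A = A' - 1%:M by rewrite addrK.
(* The bound [-1 <= A i i] is what makes the diagonal of [A'] nonnegative. *)
have sA : is_substochastic A'.
  split=> [i j|i].
    rewrite !mxE; have [->|ij] := eqVneq i j; first by rewrite -lerBlDr sub0r Ab.
    by rewrite addr0 An.
  under eq_bigr do rewrite !mxE.
  rewrite big_split /= [X in _ + X](bigD1 i) //= [X in _ + (_ + X)]big1 ?eqxx.
    by rewrite addr0 gerDr.
  by move=> j; rewrite eq_sym => /negbTE ->.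
have uA' : 1%:M - A' \in unitmx.
  by rewrite /A' opprD addrCA subrr addr0 -scaleN1r unitmxZ ?unitrN1.
exists A'; split=> //.
have [u [v uvP]] := dph_rational (cmx alpha *m (1%:M - cmx A')) (cmx A') (const_mx 1).
have v0 z : `|z| <= 1 -> v.[z] != 0.
  by move=> z1; rewrite (uvP z).1 -unitfE -unitmxE unitmx_1_sub_scale.
have qz z : `|z| <= 1 -> (cpoly q).[z] != 0 by exact: real_dominant_pole_neq0.
(* This is the desired equality [p / q = z u / v] with denominators cleared; ['X] is the factor [z]
   in front of the resolvent. *)
have pq : cpoly p * v - cpoly q * ('X * u) = 0.
  (* The sample point [1 / (k + 1)] is the image of [s = k], where the continuous-time formula
     applies. *)
  apply: poly_eq0_inv_nat => k; set z := _^-1.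
  have k0 : 0 <= complex.Re (k%:R : R[i]).
    by rewrite -[k%:R](rmorph_nat (real_complex R)) /= ler0n.
  have zE : (k%:R + 1)^-1 = z by rewrite /z -natr1.
  have [s1 z1] := norm_inv_add1_le1 k0; rewrite zE in z1.
  have := GA _ k0; rewrite div1r zE GE // AE dph_resolvent ?zE //; last first.
    exact: unitmx_1_sub_scale.
  rewrite (uvP z).2 ?v0 // mulrA => /eqP; rewrite eqr_div ?qz ?v0 // => /eqP e.
  by rewrite hornerD hornerN !hornerM hornerX e mulrC subrr.
(* Now [z] is any point of the closed disc: evaluate the polynomial identity there and divide by [q]
   and [v], both nonzero. *)
move=> z z1; rewrite GE // (uvP z).2 ?v0 // mulrA; apply/eqP.
rewrite eqr_div ?qz ?v0 //; move/(congr1 (horner^~ z))/eqP: pq.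
by rewrite hornerD hornerN !hornerM hornerX horner0 subr_eq0 => /eqP ->; rewrite mulrC.
Qed.
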